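(* Let $X$ be a real Hilbert space and let $J:X\to\mathbf{R}$ be a functional with $J(0)=0$. For $r>0$ put $S_r=\{x\in X:\|x\|^2=r\}$ and $B_r=\{x\in X:\|x\|^2\le r\}$. For some $\rho>0$, assume that $J$ is Gâteaux differentiable in $\mathrm{int}(B_\rho)\setminus\{0\}$ and that $$\frac{\beta_\rho}{\rho}<\delta_\rho,\qquad\text{where}\qquad \beta_\rho=\sup_{B_\rho}J,\quad \delta_\rho=\sup_{x\in B_\rho\setminus\{0\}}\frac{J(x)}{\|x\|^2}.$$ Assume also that, for some $a>0$, with $a>\frac{\rho}{\rho\delta_\rho-\beta_\rho}$ if $\delta_\rho<+\infty$, the restriction of the functional $\|\cdot\|^2-aJ(\cdot)$ to $B_\rho$ is sequentially weakly lower semicontinuous. Then there exist a non-empty open interval $I\subseteq\,]0,+\infty[$ and an increasing function $\varphi:I\to\,]0,\rho[$ such that, for each $\lambda\in I$, one has $$\emptyset\ne\left\{x\in S_{\varphi(\lambda)}:J(x)=\sup_{S_{\varphi(\lambda)}}J\right\}\subseteq\{x\in X:x=\lambda J'(x)\}.$$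
   Context: $]s,t[$ denotes the open interval with endpoints $s,t$. The quantity $\delta_\rho$ may be $+\infty$; the assumption $\beta_\rho/\rho<\delta_\rho$ in particular requires $\beta_\rho<+\infty$. ''Increasing'' means strictly increasing. The Gâteaux derivative $J'(x)\in X^*$ is identified with an element of $X$ via the Riesz theorem; the set $\{x\in X:x=\lambda J'(x)\}$ consists of points $x$ at which $J$ is Gâteaux differentiable and the equation holds. $\mathrm{int}(B_\rho)=\{x\in X:\|x\|^2<\rho\}$. *)

(* Defs.v *)
From HB Require Import structures.
From mathcomp Require Export all_boot all_order all_algebra.
From mathcomp Require Export all_classical all_reals all_analysis.
Export Order.TTheory GRing.Theory Num.Theory.
Export numFieldNormedType.Exports.

Set Implicit Arguments.
Unset Strict Implicit.
Unset Printing Implicit Defensive.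

Local Open Scope classical_set_scope.
Local Open Scope ring_scope.

(* A real Hilbert space is a complete normed module [X] over [R] together with
   an inner product [ip] satisfying this predicate. *)
Definition induces_norm (R : realType) (X : normedModType R)
    (ip : {dot X for @idfun R}) : Prop :=
  forall x : X, ip x x = `|x| ^+ 2.

(* The radius enters squared: [r] is the square of the usual radius. *)
Definition sqsphere (R : realType) (X : normedModType R) (r : R) : set X :=
  [set x : X | `|x| ^+ 2 = r].

Definition sqball (R : realType) (X : normedModType R) (r : R) : set X :=
  [set x : X | `|x| ^+ 2 <= r].

Definition open_sqball (R : realType) (X : normedModType R) (r : R) : set X :=
  [set x : X | `|x| ^+ 2 < r].

Definition esup_on (R : realType) (T : Type) (A : set T) (f : T -> R) : \bar R :=
  ereal_sup [set (f x)%:E | x in A].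

(* The directional derivatives exist and define an element of the dual. *)
Definition gateaux_differentiable (R : realType) (X : normedModType R)
    (J : X -> R) (x : X) : Prop :=
  [/\ forall v : X, derivable J x v,
      scalar (fun v : X => 'D_v J x : R)
    & continuous (fun v : X => 'D_v J x : R)].

(* [g] is the Riesz representative of the Gateaux derivative of [J] at [x]. *)
Definition is_gateaux_gradient (R : realType) (X : normedModType R)
    (ip : {dot X for @idfun R}) (J : X -> R) (x g : X) : Prop :=
  gateaux_differentiable J x /\ forall v : X, 'D_v J x = ip g v.

Definition weakly_cvg (R : realType) (X : normedModType R)
    (u : nat -> X) (x : X) : Prop :=
  forall f : {scalar X}, continuous (f : X -> R) ->
    (fun n => f (u n) : R) @ \oo --> (f x : R).

Definition seq_weak_lsc_on (R : realType) (X : normedModType R)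
    (A : set X) (f : X -> R) : Prop :=
  forall (u : nat -> X) (x : X), (forall n, A (u n)) -> A x ->
    weakly_cvg u x ->
    ((f x)%:E <= limn_einf (fun n => (f (u n))%:E))%E.

(* Main.v *)
(** Put mu = 2 lambda and f_mu(x) = |x|^2 - mu J(x).  A critical point of f_mu
    solves x = lambda J'(x), so it suffices to find, for mu in some interval,
    a global minimiser w_mu of f_mu on B_rho that is interior and nonzero, and
    to set phi(lambda) = |w_mu|^2: on the sphere through w_mu the maximisers of
    J are exactly the global minimisers of f_mu lying there.
    The interval is 1/d < mu < 1/c with c = max(beta/rho, 1/a) < d = J(x0)/|x0|^2
    for a suitable x0; such an x0 exists because a > rho/(rho delta - beta)
    >= 1/delta.  Then mu < a makes f_mu = (1 - mu/a)|x|^2 + (mu/a) f_a weakly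
    lower semicontinuous, mu beta < rho makes minimisers interior, and
    f_mu(x0) < 0 makes them nonzero.
    Monotonicity of phi is the usual comparison of minimisers; it is strict
    since two parameters sharing a norm would share a minimiser x, whence
    x / mu1 = x / mu2.  *)
Require Import Defs.
From mathcomp Require Import all_boot all_order all_algebra.
From mathcomp Require Import all_classical all_reals all_analysis.
From mathcomp Require Import ring lra.

Set Implicit Arguments.
Unset Strict Implicit.
Unset Printing Implicit Defensive.

Local Open Scope classical_set_scope.
Local Open Scope ring_scope.

(** * Inner product identities and Cauchy-Schwarz *)

Section Inner.
Context (R : realType) (X : normedModType R) (ip : {dot X for @idfun R}).
Context (hip : induces_norm ip).

Lemma ipC (u v : X) : ip u v = ip v u.
Proof. by rewrite hermC expr0 mul1r. Qed.

Lemma ipDr (u v w : X) : ip u (v + w) = ip u v + ip u w.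
Proof. exact: linearDr. Qed.

Lemma ipDl (u v w : X) : ip (u + v) w = ip u w + ip v w.
Proof. by rewrite ipC ipDr !(ipC w). Qed.

Lemma ipZr (t : R) (u v : X) : ip u (t *: v) = t * ip u v.
Proof. exact: linearZr_LR. Qed.

Lemma ipZl (t : R) (u v : X) : ip (t *: u) v = t * ip u v.
Proof. by rewrite ipC ipZr ipC. Qed.

Lemma ipBr (u v w : X) : ip u (v - w) = ip u v - ip u w.
Proof. by rewrite ipDr -scaleN1r ipZr mulN1r. Qed.

Lemma ipBl (u v w : X) : ip (u - v) w = ip u w - ip v w.
Proof. by rewrite ipC ipBr !(ipC w). Qed.

Lemma sqnormD (u v : X) :
  `|u + v| ^+ 2 = `|u| ^+ 2 + 2 * ip u v + `|v| ^+ 2.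
Proof. by rewrite -!hip ipDl !ipDr (ipC v u); ring. Qed.

Lemma sqnormB (u v : X) :
  `|u - v| ^+ 2 = `|u| ^+ 2 - 2 * ip u v + `|v| ^+ 2.
Proof. by rewrite -!hip ipBl !ipBr (ipC v u); ring. Qed.

Lemma sqnormZ (t : R) (u : X) : `|t *: u| ^+ 2 = t ^+ 2 * `|u| ^+ 2.
Proof. by rewrite -!hip ipZl ipZr; ring. Qed.

(** The triangle inequality of the given norm suffices: expand [|x + y|^2 <= (|x| + |y|)^2], then
    pass to [- u] for the other sign. *)
Lemma ip_norm_le (u v : X) : `|ip u v| <= `|u| * `|v|.
Proof.
have H (x y : X) : ip x y <= `|x| * `|y|.
  have : `|x + y| ^+ 2 <= (`|x| + `|y|) ^+ 2.
    by rewrite ler_pXn2r ?nnegrE ?addr_ge0// ler_normD.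
  by rewrite sqnormD sqrrD; lra.
rewrite ler_norml H andbT lerNl.
by rewrite -mulN1r -ipZl scaleN1r (le_trans (H _ _))// normrN.
Qed.
End Inner.

(** * Riesz representation on closed subspaces *)

Section Riesz.
Context (R : realType) (X : completeNormedModType R).
Context (ip : {dot X for @idfun R}) (hip : induces_norm ip).

(* Minimise |v|^2 - 2 f v over V: the parallelogram identity makes minimising
   sequences Cauchy.  V = setT gives the Riesz theorem, f = ip x the orthogonal
   projection of x on V. *)
Lemma closed_subspace_riesz (V : set X) (f : X -> R) (C : R) :
  V 0 -> (forall (t : R) (u v : X), V u -> V v -> V (t *: u + v)) ->
  closed V -> scalar f -> (forall v, `|f v| <= C * `|v|) ->
  exists2 p, V p & forall v, V v -> ip p v = f v.
Proof.
move=> V0 VL Vcl fL fC.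
have fD t u v : f (t *: u + v) = t * f u + f v by exact: fL.
have fZ t u : f (t *: u) = t * f u.
  have f0 : f 0 = 0.
    by apply/normr0_eq0/le_anti; rewrite normr_ge0 (le_trans (fC 0))// normr0 mulr0.
  by have := fD t u 0; rewrite addr0 f0 addr0.
pose Q v : R := `|v| ^+ 2 - 2 * f v.
pose m := inf (Q @` V).
have Qinf : has_inf (Q @` V).
  split; first by exists (Q 0); exists 0.
  exists (- C ^+ 2) => _ [v Vv <-]; rewrite /Q.
  by have := fC v; rewrite ler_norml => /andP[_]; have := sqr_ge0 (C - `|v|); nra.
have mQ v : V v -> m <= Q v.
  by move=> Vv; apply: ge_inf; [case: Qinf|exists v].
have /choice[v_ v_P] : forall n, exists v, V v /\ Q v < m + harmonic n.
  move=> n; have [_ [v Vv <-] Qv] := inf_adherent (@harmonic_gt0 R n) Qinf.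
  by exists v.
have v_near n : forall v, V v ->
    (ip (v_ n) v - f v) ^+ 2 <= (`|v| ^+ 2 + 1) * harmonic n.
  move=> v Vv; have [Vn Qn] := v_P n.
  (* Moving [v_ n] by [- d / s] times [v] lowers [Q] by at least [d ^+ 2 / s], while near-minimality
     allows less than [harmonic n]. The 1 in [s] keeps it nonzero when [v = 0]. *)
  set s : R := `|v| ^+ 2 + 1; set d : R := ip (v_ n) v - f v.
  have s0 : 0 < s by rewrite ltr_wpDl// sqr_ge0.
  have := mQ _ (VL (- d / s) _ _ Vv Vn).
  have -> : Q ((- d / s) *: v + v_ n) = Q (v_ n) - d ^+ 2 / s * (1 + s^-1).
    rewrite /Q (sqnormD hip) (sqnormZ hip) fD ipZl (ipC _ v).
    rewrite (_ : `|v| ^+ 2 = s - 1); last by rewrite /s addrK.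
    rewrite (_ : f v = ip (v_ n) v - d); last by rewrite /d; ring.
    by field; rewrite gt_eqF.
  move=> H; rewrite mulrC -ler_pdivrMr//.
  have : 0 <= d ^+ 2 / s * s^-1 by rewrite !divr_ge0 ?sqr_ge0// ltW.
  move: H Qn; move: (d ^+ 2 / s) => z; rewrite mulrDr; lra.
have v_dist n k : `|v_ n - v_ k| ^+ 2 < 2 * harmonic n + 2 * harmonic k.
  have [[Vn Qn] [Vk Qk]] := (v_P n, v_P k).
  (* The midpoint of [v_ n] and [v_ k] is the competitor. *)
  have := mQ _ (VL 2^-1 _ _ Vn (VL 2^-1 _ _ Vk V0)).
  move: Qn Qk; rewrite /Q addr0 (sqnormB hip) (sqnormD hip) !(sqnormZ hip).
  by rewrite fD fZ ipZl ipZr !exprVn; lra.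
have v_cauchy : cvgn v_.
  apply/cauchy_cvgP/cauchyP => e e0.
  have e20 : 0 < e ^+ 2 / 4 by rewrite divr_gt0// exprn_gt0.
  have [N hN] := filter_ex (cvgr_lt _ (@cvg_harmonic R) _ e20).
  exists (v_ N), N => // n Nn; rewrite -ball_normE /=.
  rewrite -(@ltr_pXn2r _ 2)// ?nnegrE ?(ltW e0)//.
  have : harmonic n <= harmonic N :> R.
    by rewrite /harmonic lef_pV2 ?posrE// ler_nat.
  by move: hN (v_dist N n) => {v_near v_dist} ? ? ?; lra.
have [p vp] := (cvg_ex _).1 v_cauchy.
have Vp : V p.
  by apply: (closed_cvg V Vcl _ p vp); apply: nearW => n; have [] := v_P n.
exists p => // v Vv.
have ip_cvg : (fun n => ip (v_ n) v) @ \oo --> ip p v.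
  apply/cvgrPdist_le => e e0.
  have d0 : 0 < e / (`|v| + 1) by rewrite divr_gt0// ltr_wpDl.
  near=> n.
  rewrite -ipBl (le_trans (ip_norm_le hip _ _))//.
  have : `|p - v_ n| <= e / (`|v| + 1).
    near: n; exact: (cvgrPdist_le _ _).1 vp _ d0.
  rewrite ler_pdivlMr ?ltr_wpDl//; apply: le_trans.
  by rewrite ler_wpM2l// lerDl.
apply/eqP; rewrite -subr_eq0 -sqrf_eq0 eq_le sqr_ge0 andbT.
have L1 : (fun n => ip (v_ n) v - f v) @ \oo --> ip p v - f v.
  by apply: cvgB; [exact: ip_cvg|exact: cvg_cst].
have L := cvgM L1 L1.
have L0 : (fun n => (`|v| ^+ 2 + 1) * harmonic n) @ \oo --> (0 : R).
  rewrite -(mulr0 (`|v| ^+ 2 + 1)); apply: cvgMl_tmp; exact: cvg_harmonic.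
rewrite expr2; apply: (ler_cvg_to (L _) L0); apply: nearW => n.
by rewrite /= -expr2 v_near.
Unshelve. all: by end_near. Qed.
End Riesz.

(** * Weak sequential compactness of bounded sequences *)

Section WeakCompactness.
Context (R : realType).

(** Compactness of the segment gives a cluster point, and a cluster point of an ultrafilter is a
    limit. *)
Lemma ultra_bounded_cvg (U : set_system nat) (x : nat -> R) (C : R) :
  UltraFilter U -> (forall n, `|x n| <= C) ->
  exists l : R, x @ U --> l.
Proof.
move=> UU xC.
have Uprop : ProperFilter U by exact: ultra_proper.
have [l [_ lP]] : `[- C, C] `&` cluster (x @ U) !=set0.
  apply: segment_compact.
  suff : U (x @^-1` `[- C, C]) by [].
  by apply: filterE => n /=; rewrite in_itv/= -ler_norml; exact: xC.
exists l => B lB.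
have [//|UB] := in_ultra_setVsetC (x @^-1` B) UU.
by have [z [/=]] := lP (~` B) B UB lB.
Qed.

Context (X : completeNormedModType R).
Context (ip : {dot X for @idfun R}) (hip : induces_norm ip).

(** By Riesz on the whole space, every continuous functional is some [ip p]. *)
Lemma weakly_cvg_ip (u : nat -> X) (w : X) :
  (forall v, (fun n => ip v (u n)) @ \oo --> ip v w) -> weakly_cvg u w.
Proof.
move=> H f /linear_bounded_continuous/linear_boundedP fb.
have /filter_ex[C fC] := fb.
have [//|//|||//|p _ pP] := @closed_subspace_riesz R X ip hip setT f C.
- exact: closedT.
- exact: linearP.
rewrite -pP//; under eq_fun do rewrite -pP//.
exact: H.
Qed.

Lemma ip_cvg_weakly (u : nat -> X) (w v : X) :
  weakly_cvg u w -> (fun n => ip v (u n)) @ \oo --> ip v w.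
Proof.
move=> uw; apply: (uw (ip v)) => x.
apply/cvgrPdist_le => e e0.
have d0 : 0 < e / (`|v| + 1) by rewrite divr_gt0// ltr_wpDl.
near=> y.
rewrite -ipBr (le_trans (ip_norm_le hip _ _))//.
have : `|x - y| <= e / (`|v| + 1).
  by near: y; apply: (@cvgr_dist_le _ _ _ _ _ id) => //; exact: cvg_id.
rewrite ler_pdivlMr ?ltr_wpDl//; apply: le_trans.
by rewrite mulrC ler_wpM2l// lerDl.
Unshelve. all: by end_near. Qed.

(* The limit w is obtained along an ultrafilter U, so no diagonal extraction is
   needed: s j is chosen so that u (s j) is close to w against u 0, ..., u j.
   Vectors orthogonal to every u k are orthogonal to w too, so the projection
   on the closed subspace V settles the convergence against all of X. *)
Lemma bounded_weakly_cvg_subseq (u : nat -> X) (C : R) :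
  (forall n, `|u n| <= C) ->
  exists (s : nat -> nat) (w : X),
    (forall n, (n <= s n)%N) /\ weakly_cvg (u \o s) w.
Proof.
move=> uC.
have C0 : 0 <= C by rewrite (le_trans _ (uC 0%N)).
have [U [UU oU]] := ultraFilterLemma (@eventually_filter).
have Uprop : ProperFilter U by exact: ultra_proper.
have ipuC v n : `|ip v (u n)| <= `|v| * C.
  by rewrite (le_trans (ip_norm_le hip _ _))// ler_wpM2l.
have /choice[L LP] v : exists l : R, (fun n => ip v (u n)) @ U --> l.
  by apply: (ultra_bounded_cvg UU) => n; exact: ipuC.
(* Linearity and the bound [C] pass to the limit along [U], so [L] is represented by a vector
   [w]. *)
have [//|//||||w _ wP] := @closed_subspace_riesz R X ip hip setT L C.
- exact: closedT.
- move=> t a b.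
  apply: (norm_cvg_unique (LP _)) => /=.
  under eq_fun do rewrite ipDl ipZl.
  by apply: cvgD (LP b); apply: cvgMl_tmp; exact: LP.
- move=> v; rewrite mulrC.
  apply: (@ler_cvg_to _ _ _ R _ (fun=> `|v| * C) _ _ (cvg_norm (LP v))).
    exact: cvg_cst.
  by apply: nearW => n; exact: ipuC.
have {LP} wP v : (fun n => ip v (u n)) @ U --> ip v w.
  by rewrite (ipC _ v w) wP.
have /choice[s sP] j : exists n, (j <= n)%N /\
    forall i : 'I_j.+1, `|ip (u i) w - ip (u i) (u n)| < harmonic j.
  have Uge : U [set n | (j <= n)%N] by apply: oU; exists j.
  have Uip : U [set n | forall i : 'I_j.+1,
      `|ip (u i) w - ip (u i) (u n)| < harmonic j].
    apply: filter_forall => i.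
    by have /cvgrPdist_lt/(_ _ (harmonic_gt0 j)) := wP (u i).
  exact: filter_ex (filterI Uge Uip).
exists s, w; split=> [n|]; first by have [] := sP n.
apply: weakly_cvg_ip => v /=.
(* The vectors against which [u \o s] has the required limit; the goal is that [v] is one of
   them. *)
pose V := [set z | (fun n => ip z (u (s n))) @ \oo --> ip z w].
have V0 : V 0.
  by rewrite /V/= linear0l; under eq_fun do rewrite linear0l; exact: cvg_cst.
have VL t a b : V a -> V b -> V (t *: a + b).
  rewrite /V/= => Va Vb; rewrite ipDl ipZl; under eq_fun do rewrite ipDl ipZl.
  by apply: cvgD Vb; exact: cvgMl_tmp.
have Vcl : closed V.
  move=> z zV; apply/cvgrPdist_le => e e0.
  pose M := C + `|w| + 1.
  have M0 : 0 < M by rewrite ltr_wpDl// addr_ge0.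
  have d0 : 0 < e / (2 * M) by rewrite divr_gt0// mulr_gt0.
  have [z' [Vz']] := zV _ (nbhsx_ballx z _ d0).
  rewrite -ball_normE /= => zz'.
  have e20 : 0 < e / 2 by rewrite divr_gt0.
  near=> n.
  have -> : ip z w - ip z (u (s n)) =
      ip (z - z') (w - u (s n)) + (ip z' w - ip z' (u (s n))).
    by rewrite !ipBl !ipBr; ring.
  rewrite (le_trans (ler_normD _ _))// (_ : e = e / 2 + e / 2); last by field.
  rewrite lerD//; last first.
    by near: n; exact: (cvgrPdist_le _ _).1 Vz' _ e20.
  rewrite (le_trans (ip_norm_le hip _ _))//.
  have : `|w - u (s n)| <= M.
    rewrite (le_trans (ler_normB _ _))// /M.
    by have := uC (s n); lra.
  have -> : e / 2 = e / (2 * M) * M by field; rewrite gt_eqF.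
  by move=> ?; rewrite ler_pM// ltW.
have Vu k : V (u k).
  apply/cvgrPdist_lt => e e0.
  near=> n.
  have kn : (k <= n)%N by near: n; exists k.
  (* The choice of [s n] controls all indices up to [n], hence [k]. *)
  have [_ /(_ (Ordinal (kn : k < n.+1)%N))/= /lt_trans] := sP n; apply.
  by near: n; exact: (cvgr_lt _ (@cvg_harmonic R) _ e0).
have [//|//|//|||p Vp pP] := @closed_subspace_riesz R X ip hip V (ip v) `|v|.
- exact: linearP.
- by move=> z; exact: ip_norm_le.
have qu k : ip (v - p) (u k) = 0 by rewrite ipBl pP// subrr.
have qw : ip (v - p) w = 0.
  apply: (norm_cvg_unique (wP _)) => /=.
  by under eq_fun do rewrite qu; exact: cvg_cst.
have Vq : V (v - p).
  by rewrite /V/= qw; under eq_fun do rewrite qu; exact: cvg_cst.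
by have := VL 1 _ _ Vq Vp; rewrite scale1r subrK.
Unshelve. all: by end_near. Qed.
End WeakCompactness.

(** * Existence of minimisers by the direct method *)

Section Minimizer.
Context (R : realType).

(** The limit inferior is the supremum of the infima over tails, so one of these already exceeds
    [f x - e]. *)
Lemma seq_weak_lsc_near (X : normedModType R) (A : set X) (f : X -> R)
    (u : nat -> X) (x : X) (e : R) :
  seq_weak_lsc_on A f -> (forall n, A (u n)) -> A x -> weakly_cvg u x ->
  0 < e -> \forall n \near \oo, f x - e < f (u n).
Proof.
move=> flsc Au Ax ux e0.
have := flsc u x Au Ax ux; set F := fun n => (f (u n))%:E.
rewrite limn_einf_lim (cvg_lim _ (@cvg_einfs_sup _ F))// => fx.
have /ereal_sup_gt[_ [N _ <-] FN] : ((f x - e)%:E < ereal_sup (range (einfs F)))%E.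
  by apply: lt_le_trans fx; rewrite lte_fin ltrBlDr ltrDl.
exists N => // n /= Nn; rewrite -lte_fin (lt_le_trans FN)//.
by apply: ereal_inf_lbound; exists n.
Qed.

Context (X : completeNormedModType R).
Context (ip : {dot X for @idfun R}) (hip : induces_norm ip).

(** Expanding [|x - u n|^2 >= 0] gives [|u n|^2 >= 2 * ip x (u n) - |x|^2], whose right side tends
    to [|x|^2]. *)
Lemma sqnorm_seq_weak_lsc_near (u : nat -> X) (x : X) (e : R) :
  weakly_cvg u x -> 0 < e -> \forall n \near \oo, `|x| ^+ 2 - e < `|u n| ^+ 2.
Proof.
move=> ux e0.
have xe : `|x| ^+ 2 - e / 2 < ip x x by rewrite hip; lra.
near=> n.
have : `|x| ^+ 2 - e / 2 < ip x (u n).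
  by near: n; exact: (cvgr_gt _ (ip_cvg_weakly hip (v := x) ux) _ xe).
by have := sqr_ge0 `|x - u n|; rewrite (sqnormB hip); lra.
Unshelve. all: by end_near. Qed.

Lemma sqball_weakly_closed (rho : R) (u : nat -> X) (x : X) :
  (forall n, sqball rho (u n)) -> weakly_cvg u x -> sqball rho x.
Proof.
move=> uB ux; apply/ler_addgt0Pr => e e0.
have [n xn] := filter_ex (sqnorm_seq_weak_lsc_near ux e0).
by have := uB n; rewrite /sqball/=; lra.
Qed.

Lemma exists_minimizer (rho a mu b : R) (J : X -> R) :
  0 <= rho -> 0 < mu <= a -> (forall x, sqball rho x -> J x <= b) ->
  seq_weak_lsc_on (sqball rho) (fun x => `|x| ^+ 2 - a * J x) ->
  exists2 w, sqball rho w &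
    forall x, sqball rho x -> `|w| ^+ 2 - mu * J w <= `|x| ^+ 2 - mu * J x.
Proof.
move=> rho0 /andP[mu0 mua] Jb Jlsc.
have a0 : 0 < a by exact: lt_le_trans mua.
pose f x := `|x| ^+ 2 - mu * J x.
pose m := inf (f @` sqball rho).
have finf : has_inf (f @` sqball rho).
  split; first by exists (f 0), 0 => //; rewrite /sqball/= normr0 expr0n.
  exists (- (mu * b)) => _ [x Bx <-]; rewrite /f.
  by have := sqr_ge0 `|x|; have := Jb _ Bx; nra.
have /choice[u uP] n : exists x, sqball rho x /\ f x < m + harmonic n.
  have [_ [x Bx <-] fx] := inf_adherent (@harmonic_gt0 R n) finf.
  by exists x.
have uC n : `|u n| <= Num.sqrt rho.
  by rewrite -(ger0_norm (normr_ge0 _)) -sqrtr_sqr ler_wsqrtr//; have [] := uP n.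
have [s [w [sge sw]]] := bounded_weakly_cvg_subseq hip uC.
have sB n : sqball rho (u (s n)) by have [] := uP (s n).
have Bw := sqball_weakly_closed sB sw.
exists w => // x Bx.
have mx : m <= f x by apply: ge_inf; [case: finf|exists x].
apply: (le_trans _ mx); apply/ler_addgt0Pr => e e0.
have e20 : 0 < e / 2 by rewrite divr_gt0.
near \oo => n.
have H1 : `|w| ^+ 2 - a * J w - e / 2 < `|u (s n)| ^+ 2 - a * J (u (s n)).
  by near: n; exact: (seq_weak_lsc_near Jlsc sB Bw sw e20).
have H2 : `|w| ^+ 2 - e / 2 < `|u (s n)| ^+ 2.
  by near: n; exact: (sqnorm_seq_weak_lsc_near sw e20).
have H3 : f (u (s n)) < m + e / 2.
  have [_ /lt_le_trans] := uP (s n); apply; rewrite lerD2l.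
  apply: (@le_trans _ _ (harmonic n)).
    by rewrite /harmonic lef_pV2 ?posrE// ler_nat ltnS.
  by near: n; exact: (cvgr_le _ (@cvg_harmonic R) _ e20).
(* After multiplication by [a], the claim is [H1] weighted by [mu] plus [H2] weighted by [a - mu],
   combined with [H3]. *)
rewrite -(ler_pM2l a0) ltW//.
move: H1 H2 H3; rewrite /f; nra.
Unshelve. all: by end_near. Qed.

End Minimizer.

(** * First-order condition at an interior minimiser *)

Section CriticalPoint.
Context (R : realType) (X : normedModType R).
Context (ip : {dot X for @idfun R}) (hip : induces_norm ip).
Context (rho mu : R) (J : X -> R) (w : X).
Context (mu0 : 0 < mu) (wrho : open_sqball rho w).
Context (wmin : forall x, sqball rho x ->
  `|w| ^+ 2 - mu * J w <= `|x| ^+ 2 - mu * J x).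

(** For small [h > 0], minimality against [h *: v + w] bounds [mu] times the difference quotient by
    [2 * ip w v + h * |v|^2]; let [h] tend to 0. *)
Lemma minimizer_derive_le (v : X) :
  derivable J w v -> mu * 'D_v J w <= 2 * ip w v.
Proof.
move=> /cvg_dnbhs_at_right Jv.
have Jmu : (fun h => mu * (h^-1 * (J (h *: v + w) - J w))) @ (0 : R)^'+ -->
    mu * 'D_v J w by apply: cvgMl_tmp; exact: Jv.
have L : (fun h => 2 * ip w v + h * `|v| ^+ 2) @ (0 : R)^'+ --> 2 * ip w v.
  rewrite -[X in _ --> X]addr0 -[X in _ --> _ + X](mul0r (`|v| ^+ 2)).
  by apply: cvgD; [exact: cvg_cst|apply: cvgMr_tmp; exact: cvg_within].
apply: (ler_cvg_to Jmu L).
(* For [0 < h < 1] the squared norm grows by at most [h * K], which keeps the competitor in the ball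
   once [h] is small. *)
pose K := 2 * `|ip w v| + `|v| ^+ 2 + 1.
have K0 : 0 < K by rewrite ltr_wpDl// addr_ge0// ?mulr_ge0// sqr_ge0.
have rw0 : 0 < rho - `|w| ^+ 2 by rewrite subr_gt0.
near=> h.
have h0 : 0 < h by near: h; exact: nbhs_right_gt.
have h1 : h < 1 by near: h; exact: nbhs_right_lt.
have hK : h * K < rho - `|w| ^+ 2.
  by rewrite -ltr_pdivlMr//; near: h; apply: nbhs_right_lt; rewrite divr_gt0.
have yE : `|h *: v + w| ^+ 2 = `|w| ^+ 2 + h * (2 * ip w v + h * `|v| ^+ 2).
  by rewrite addrC (sqnormD hip) (sqnormZ hip) ipZr; ring.
have yB : sqball rho (h *: v + w).
  rewrite /sqball/= yE.
  have : h * (2 * ip w v + h * `|v| ^+ 2) <= h * K.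
    rewrite ler_pM2l// /K; have := ler_norm (ip w v); have := sqr_ge0 `|v|; nra.
  by move: hK; lra.
have := wmin yB; rewrite yE => H.
rewrite mulrCA -ler_pdivlMl ?invr_gt0// invrK.
by move: H; lra.
Unshelve. all: by end_near. Qed.

(** The one-sided bounds for [v] and [- v] combine into an equality because the derivative is
    linear. *)
Lemma minimizer_gradient :
  gateaux_differentiable J w -> is_gateaux_gradient ip J w ((2 / mu) *: w).
Proof.
move=> wd; split=> // v; have [wder wlin _] := wd.
have DN : 'D_(- v) J w = - 'D_v J w :> R.
  have D0 : 'D_(0 : X) J w = 0 :> R
    by have := wlin (-1) 0 0; rewrite scaler0 addr0 /=; lra.
  by have := wlin (-1) v 0; rewrite addr0 scaleN1r D0 /= => ->; lra.
have := minimizer_derive_le (wder v).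
have := minimizer_derive_le (wder (- v)).
rewrite DN ipZl -(scaleN1r v) ipZr => H1 H2.
apply: (mulfI (lt0r_neq0 mu0)); apply/le_anti.
have -> : mu * (2 / mu * ip w v) = 2 * ip w v by field; rewrite gt_eqF.
by apply/andP; split; lra.
Qed.

End CriticalPoint.

(** * Location and comparison of minimisers *)

Section Minimizers.
Context (R : realType) (X : normedModType R) (rho : R) (J : X -> R).

Definition is_minimizer (mu : R) (w : X) : Prop :=
  sqball rho w /\ forall x, sqball rho x ->
    `|w| ^+ 2 - mu * J w <= `|x| ^+ 2 - mu * J x.

(** Comparison with 0 gives [|w|^2 <= mu * J w <= mu * b < rho]. *)
Lemma minimizer_interior (mu b : R) (w : X) :
  0 <= rho -> J 0 = 0 -> 0 < mu -> mu * b < rho ->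
  (forall x, sqball rho x -> J x <= b) ->
  is_minimizer mu w -> open_sqball rho w.
Proof.
move=> rho0 J0 mu0 mub Jb [Bw wmin].
have := wmin 0; rewrite /sqball/= normr0 expr0n/= J0 mulr0 subr0.
move=> /(_ rho0); rewrite subr_le0 => /le_lt_trans; apply.
by rewrite (le_lt_trans _ mub)// ler_pM2l// Jb.
Qed.

Lemma minimizer_neq0 (mu : R) (w x : X) :
  J 0 = 0 -> sqball rho x -> `|x| ^+ 2 - mu * J x < 0 ->
  is_minimizer mu w -> w != 0.
Proof.
move=> J0 Bx fx0 [_ wmin]; apply/eqP => w0.
by have := wmin _ Bx; rewrite w0 normr0 expr0n/= J0 mulr0 subr0 leNgt fx0.
Qed.

(** Adding the two minimality inequalities yields [J w1 <= J w2]; the first one then orders the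
    norms. *)
Lemma minimizer_le (mu1 mu2 : R) (w1 w2 : X) :
  0 < mu1 < mu2 -> is_minimizer mu1 w1 -> is_minimizer mu2 w2 ->
  `|w1| ^+ 2 <= `|w2| ^+ 2.
Proof.
move=> /andP[mu1_gt0 mu12] [Bw1 min1] [Bw2 min2].
have H1 := min1 _ Bw2; have H2 := min2 _ Bw1.
have : J w1 <= J w2.
  by rewrite -(@ler_pM2l _ (mu2 - mu1)) ?subr_gt0//; lra.
by rewrite -(ler_pM2l mu1_gt0); lra.
Qed.

(** On a fixed sphere, [|x|^2 - mu * J x] depends on [J x] alone and decreases in it. *)
Lemma minimizer_sphere (mu : R) (w x : X) :
  is_minimizer mu w -> `|x| ^+ 2 = `|w| ^+ 2 -> J w <= J x -> 0 < mu ->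
  is_minimizer mu x.
Proof.
move=> [Bw wmin] xw Jwx mu0; split; first by rewrite /sqball/= xw.
move=> y /wmin; apply: le_trans.
by rewrite xw lerD2l lerN2 ler_pM2l.
Qed.

Lemma minimizer_sphere_max (mu : R) (w x : X) :
  0 < mu -> is_minimizer mu w -> `|x| ^+ 2 = `|w| ^+ 2 -> J x <= J w.
Proof.
move=> mu0 [Bw wmin] xw.
have := wmin x; rewrite /sqball/= xw lerD2l lerN2 ler_pM2l//; exact.
Qed.

Lemma minimizer_lt (ip : {dot X for @idfun R}) (mu1 mu2 : R) (w1 w2 : X) :
  induces_norm ip -> 0 < mu1 < mu2 ->
  is_minimizer mu1 w1 -> is_minimizer mu2 w2 ->
  open_sqball rho w1 -> w1 != 0 -> gateaux_differentiable J w1 ->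
  `|w1| ^+ 2 < `|w2| ^+ 2.
Proof.
move=> hip mu12 min1 min2 w1rho w10 w1d.
rewrite lt_neqAle (minimizer_le mu12 min1 min2) andbT; apply/eqP => n12.
have /andP[mu1_gt0 mu12'] := mu12.
have mu2_gt0 : 0 < mu2 by exact: lt_trans mu12'.
have min21 : is_minimizer mu2 w1.
  apply: (minimizer_sphere min2) => //.
  by apply: (minimizer_sphere_max mu1_gt0 min1); rewrite n12.
have [_ g1] := minimizer_gradient hip mu1_gt0 w1rho min1.2 w1d.
have [_ g2] := minimizer_gradient hip mu2_gt0 w1rho min21.2 w1d.
(* Both gradient formulas, tested on [w1], give [2 / mu2 * |w1|^2 = 2 / mu1 * |w1|^2], and [w1] is
   nonzero. *)
have := g1 w1; rewrite g2 !ipZl => /mulIf H.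
have : 2 / mu2 = 2 / mu1.
  by apply: H; rewrite hip sqrf_eq0 normr_eq0.
move=> /(mulfI (lt0r_neq0 (ltr0Sn R 1))) mu21V; have mu21 := GRing.invr_inj mu21V.
by move: mu12'; rewrite mu21 ltxx.
Qed.

End Minimizers.

(** * Choice of the interval and conclusion *)

Theorem theorem2 (R : realType) (X : completeNormedModType R)
    (ip : {dot X for @idfun R}) (hip : induces_norm ip)
    (J : X -> R) (J0 : J 0 = 0)
    (rho : R) (rho_gt0 : 0 < rho)
    (J_diff : forall x : X, (open_sqball rho `\ 0) x ->
       gateaux_differentiable J x)
    (beta delta : \bar R)
    (beta_def : beta = esup_on (sqball rho) J)
    (delta_def : delta =
       esup_on (sqball rho `\ (0 : X)) (fun x => J x / `|x| ^+ 2))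
    (beta_lt_delta : (beta * (rho^-1)%:E < delta)%E)
    (a : R) (a_gt0 : 0 < a)
    (a_large : (delta < +oo)%E -> rho / (rho * fine delta - fine beta) < a)
    (J_lsc : seq_weak_lsc_on (sqball rho) (fun x => `|x| ^+ 2 - a * J x)) :
  exists (I : set R) (phi : R -> R),
    [/\ [/\ open I, is_interval I, I !=set0 & I `<=` `]0, +oo[],
        set_fun I `]0, rho[ phi,
        {in I &, {homo phi : s t / s < t}}
      & forall lambda : R, I lambda ->
          let M := [set x : X | sqsphere (phi lambda) x /\
            (J x)%:E = esup_on (sqsphere (phi lambda)) J] in
          M !=set0 /\
          M `<=` [set x : X | exists2 g : X,
            is_gateaux_gradient ip J x g & x = lambda *: g]].
Proof.
have rho0 := ltW rho_gt0.
have B0 : sqball rho (0 : X) by rewrite /sqball/= normr0 expr0n.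
have Jbeta x : sqball rho x -> ((J x)%:E <= beta)%E.
  by move=> Bx; rewrite beta_def; apply: ereal_sup_ubound; exists x.
have beta_ge0 : (0%:E <= beta)%E by rewrite -J0 Jbeta.
have beta_fin : beta \is a fin_num.
  rewrite ge0_fin_numE// ltey; apply/negP => /eqP betay.
  by move: beta_lt_delta; rewrite betay gt0_mulye ?lte_fin ?invr_gt0// ltNge leey.
move: beta_fin Jbeta beta_ge0 beta_lt_delta a_large {beta_def} => /fineK <-.
move: (fine beta) => b /= Jb b_ge0 b_lt_delta a_large.
rewrite -EFinM in b_lt_delta; rewrite lee_fin in b_ge0.
have {}Jb x : sqball rho x -> J x <= b by move=> /Jb; rewrite lee_fin.
(* With [mu = 2 * l], the single condition [mu * c < 1] yields [mu * b < rho] through [bc] and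
   [mu < a] through [ac]. *)
pose c := Num.max (b / rho) a^-1.
have c_gt0 : 0 < c by rewrite lt_max invr_gt0 a_gt0 orbT.
have bc : b <= c * rho by rewrite -ler_pdivrMr// le_max lexx.
have ac : 1 <= c * a by rewrite -ler_pdivrMr// div1r le_max lexx orbT.
have c_lt_delta : (c%:E < delta)%E.
  rewrite /c EFin_max gt_max b_lt_delta /=.
  (* For a finite supremum [d], [b >= 0] gives [d^-1 <= rho / (rho * d - b) < a]. *)
  case: delta delta_def b_lt_delta a_large => [d| |] _ //; last by move=> _ _; rewrite ltry.
  rewrite !lte_fin /= => bd /(_ (ltry _)) ad.
  have d0 : 0 < d by apply: le_lt_trans bd; rewrite divr_ge0.
  rewrite invf_plt ?posrE//; apply: le_lt_trans ad.
  move: bd; rewrite ltr_pdivrMr// => bd.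
  rewrite ler_pdivlMr ?subr_gt0 1?mulrC// mulrC ler_pdivrMl//.
  by lra.
move: c_lt_delta; rewrite delta_def => /ereal_sup_gt[_ [x0 [Bx0 /eqP x00] <-]].
rewrite lte_fin; set d := J x0 / _ => cd.
have d_gt0 : 0 < d by exact: lt_trans cd.
have nx0 : 0 < `|x0| ^+ 2 by rewrite exprn_gt0// normr_gt0.
have Jx0 : J x0 = d * `|x0| ^+ 2 by rewrite /d divfK// gt_eqF.
clearbody d.
pose I : set R := `](2 * d)^-1, (2 * c)^-1[%classic.
have IP l : I l -> [/\ 0 < l, 1 < (2 * l) * d & (2 * l) * c < 1].
  rewrite /I/= in_itv/= => /andP[l1 l2].
  have l0 : 0 < l by apply: lt_trans l1; rewrite invr_gt0 mulr_gt0.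
  have dd : 0 < 2 * d by rewrite mulr_gt0.
  have cc : 0 < 2 * c by rewrite mulr_gt0.
  rewrite -(ltr_pM2l dd) mulfV ?gt_eqF// in l1.
  rewrite -(ltr_pM2l cc) mulfV ?gt_eqF// in l2.
  by split=> //; lra.
have /choice[w wP] l : exists w, I l -> is_minimizer rho J (2 * l) w.
  (* Outside [I] the value 0 is arbitrary. *)
  have [Il|] := pselect (I l); last by exists 0.
  have [l0 _ lc] := IP _ Il.
  have la : 0 < 2 * l <= a by apply/andP; split; [lra|nra].
  have [u Bu umin] := exists_minimizer hip rho0 la Jb J_lsc.
  by exists u.
(* Stated for every minimiser, since the final inclusion concerns all maximisers of [J] on the
   sphere, not just [w l]. *)
have inner l u : I l -> is_minimizer rho J (2 * l) u ->
    open_sqball rho u /\ u != 0.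
  move=> /IP[l0 ld lc] umin; split.
    by apply: (minimizer_interior rho0 J0 _ _ Jb umin); [lra|nra].
  by apply: (minimizer_neq0 J0 Bx0 _ umin); rewrite Jx0; nra.
have grad l u : I l -> is_minimizer rho J (2 * l) u ->
    gateaux_differentiable J u.
  move=> Il umin; have [urho u0] := inner _ _ Il umin.
  by apply: J_diff; split => //; exact/eqP.
exists I, (fun l => `|w l| ^+ 2); split.
- split.
  + exact: interval_open.
  + exact: interval_is_interval.
  + exists (((2 * d)^-1 + (2 * c)^-1) / 2); rewrite /I/= in_itv/=.
    have : (2 * d)^-1 < (2 * c)^-1.
      by rewrite ltf_pV2 ?posrE ?mulr_gt0// ltr_pM2l.
    by move=> ?; apply/andP; split; lra.
  + by move=> l /IP[l0 _ _]; rewrite /= in_itv/= l0.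
- move=> l Il; have [wrho w0] := inner _ _ Il (wP _ Il).
  by rewrite /= in_itv/= exprn_gt0 ?normr_gt0//=; exact: wrho.
- move=> s t /set_mem Is /set_mem It st.
  have [s0 _ _] := IP _ Is.
  have [wrho w0] := inner _ _ Is (wP _ Is).
  apply: (minimizer_lt hip _ (wP _ Is) (wP _ It)) => //.
    by apply/andP; split; lra.
  exact: grad Is (wP _ Is).
move=> l Il /=; have [l0 _ _] := IP _ Il.
have l20 : 0 < 2 * l by lra.
split.
  exists (w l); split => //.
  apply/le_anti/andP; split; first by apply: ereal_sup_ubound; exists (w l).
  apply: ge_ereal_sup => _ [x /= xw <-]; rewrite lee_fin.
  exact: minimizer_sphere_max l20 (wP _ Il) xw.
move=> x /= [xw Jx].
have xmin : is_minimizer rho J (2 * l) x.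
  apply: (minimizer_sphere (wP _ Il) xw) => //.
  by rewrite -lee_fin Jx; apply: ereal_sup_ubound; exists (w l).
have [xrho _] := inner _ _ Il xmin.
have xgrad := minimizer_gradient hip l20 xrho xmin.2 (grad _ _ Il xmin).
(* The gradient for [mu = 2 * l] is [x / l]. *)
exists ((2 / (2 * l)) *: x) => //.
rewrite scalerA (_ : l * _ = 1) ?scale1r//.
by field; rewrite gt_eqF.
Qed.
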